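(* Let $\alpha,\beta\in\mathbb{R}$ with $\alpha\neq 0$, and let $G_1$ be the connected, simply connected three-dimensional Lie group with left-invariant Lorentzian metric $g$ whose Lie algebra has a pseudo-orthonormal basis $\{\widetilde e_1,\widetilde e_2,\widetilde e_3\}$, with $\widetilde e_3$ timelike, satisfying $$[\widetilde e_1,\widetilde e_2]=\alpha\widetilde e_1-\beta\widetilde e_3,\quad [\widetilde e_1,\widetilde e_3]=-\alpha\widetilde e_1-\beta\widetilde e_2,\quad [\widetilde e_2,\widetilde e_3]=\beta\widetilde e_1+\alpha\widetilde e_2+\alpha\widetilde e_3.$$ Then the symmetrized Ricci tensor $\widetilde\rho^B$ of the Bott connection $\nabla^B$ is not a Codazzi tensor on $(G_1,\nabla^B)$.
   Context: Basis vectors are identified with left-invariant vector fields on the group $G$; $g(\widetilde e_1,\widetilde e_1)=g(\widetilde e_2,\widetilde e_2)=1$, $g(\widetilde e_3,\widetilde e_3)=-1$, and $g(\widetilde e_i,\widetilde e_j)=0$ for $i\ne j$. Let $\nabla^L$ be the Levi-Civita connection of $g$, $D=\mathrm{span}\{\widetilde e_1,\widetilde e_2\}$, $D^\perp=\mathrm{span}\{\widetilde e_3\}$ (distributions on $G$), with associated projections $\pi_D,\pi_{D^\perp}$ of $TG=D\oplus D^\perp$. The Bott connection $\nabla^B$ is the linear connection given by: $\nabla^B_XY=\pi_D(\nabla^L_XY)$ for $X,Y\in\Gamma^\infty(D)$; $\nabla^B_XY=\pi_D([X,Y])$ for $X\in\Gamma^\infty(D^\perp),Y\in\Gamma^\infty(D)$;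 $\nabla^B_XY=\pi_{D^\perp}([X,Y])$ for $X\in\Gamma^\infty(D),Y\in\Gamma^\infty(D^\perp)$; $\nabla^B_XY=\pi_{D^\perp}(\nabla^L_XY)$ for $X,Y\in\Gamma^\infty(D^\perp)$. Curvature: $R^B(X,Y)Z=\nabla^B_X\nabla^B_YZ-\nabla^B_Y\nabla^B_XZ-\nabla^B_{[X,Y]}Z$. Ricci tensor: $\rho^B(X,Y)=-g(R^B(X,\widetilde e_1)Y,\widetilde e_1)-g(R^B(X,\widetilde e_2)Y,\widetilde e_2)+g(R^B(X,\widetilde e_3)Y,\widetilde e_3)$. Symmetrized Ricci tensor: $\widetilde\rho^B(X,Y)=\tfrac12(\rho^B(X,Y)+\rho^B(Y,X))$. For a linear connection $\nabla$ and a $(0,2)$ tensor field $\omega$: $(\nabla_X\omega)(Y,Z)=X[\omega(Y,Z)]-\omega(\nabla_XY,Z)-\omega(Y,\nabla_XZ)$. The tensor $\omega$ is called a Codazzi tensor on $(G,\nabla)$ if $(\nabla_X\omega)(Y,Z)-(\nabla_Y\omega)(X,Z)=0$ for all vector fields $X,Y,Z$. *)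

(* Defs.v *)
From HB Require Import structures.
From mathcomp Require Import all_boot all_order all_algebra.
From mathcomp Require Import all_classical all_reals all_analysis.
From mathcomp Require Import ring.
Set Implicit Arguments.
Unset Strict Implicit.
Unset Printing Implicit Defensive.
Import Order.TTheory GRing.Theory Num.Theory.
Import numFieldNormedType.Exports.
Local Open Scope classical_set_scope.
Local Open Scope ring_scope.

Section SmoothMaps.
Context {R : realType} {V W : normedModType R}.
Implicit Types (U : set V) (f g : V -> W).

(* [f] is of class C^k on the open set [U]; the values of [f] outside [U] are
   irrelevant. For finite-dimensional [V], having continuous iterated
   derivatives along all constant directions is the usual notion. *)
Fixpoint class_C (k : nat) U f : Prop :=
  (forall x, U x -> {for x, continuous f}) /\
  if k is k'.+1 then
    forall v, (forall x, U x -> derivable f x v) /\ class_C k' U ('D_v f)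
  else True.

Definition smooth_on U f := forall k, class_C k U f.

Lemma class_C_ext k U f g : open U ->
  (forall x, U x -> f x = g x) -> class_C k U f -> class_C k U g.
Proof.
move=> oU fg.
have nfg h h' x : (forall x, U x -> h x = h' x) -> U x ->
    \forall y \near x, (h : V -> W) y = h' y.
  move=> hh' Ux; near=> y; apply: hh'; near: y; exact: open_nbhs_nbhs.
elim: k f g fg => [|k IH] f g fg /= [cf df]; split.
- move=> x Ux; suff : g @ x --> g x by []; rewrite -(fg x Ux).
  exact: cvg_trans (near_eq_cvg (nfg _ _ _ fg Ux)) (cf x Ux).
- by [].
- move=> x Ux; suff : g @ x --> g x by []; rewrite -(fg x Ux).
  exact: cvg_trans (near_eq_cvg (nfg _ _ _ fg Ux)) (cf x Ux).
- move=> v; have [dfv dfC] := df v; split=> [x Ux|].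
    exact: near_eq_derivable (nfg _ _ _ fg Ux) (dfv x Ux).
  apply: IH dfC => x Ux; exact: near_eq_derive (nfg _ _ _ fg Ux).
Unshelve. all: by end_near. Qed.

Lemma class_CS k U f : class_C k.+1 U f -> class_C k U f.
Proof.
elim: k f => [|k IH] f [cf df]; split=> // v.
have [dfv dfC] := df v; split=> //; exact: IH.
Qed.

Lemma class_CB k U f g : open U ->
  class_C k U f -> class_C k U g -> class_C k U (f - g).
Proof.
move=> oU; elim: k f g => [|k IH] f g /= [cf df] [cg dg]; split=> //.
- by move=> x Ux; apply: cvgB; [exact: cf | exact: cg].
- by move=> x Ux; apply: cvgB; [exact: cf | exact: cg].
move=> v; have [dfv dfC] := df v; have [dgv dgC] := dg v; split=> [x Ux|].
  by apply: derivableB; [exact: dfv | exact: dgv].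
apply: class_C_ext (IH _ _ dfC dgC) => // x Ux.
by rewrite deriveB//; [exact: dfv | exact: dgv].
Qed.

Lemma class_C_cst k U (c : W) : open U -> class_C k U (cst c).
Proof.
move=> oU; elim: k c => [|k IH] c.
  by split=> // x _; exact: cvg_cst.
split=> [x _|v]; first exact: cvg_cst.
split=> [x _|]; first exact: derivable_cst.
by apply: class_C_ext (IH 0) => // x _; rewrite derive_cst.
Qed.

End SmoothMaps.

Lemma class_CM (R : realType) (V : normedModType R) k (U : set V)
    (f g : V -> R) : open U ->
  class_C k U f -> class_C k U g -> class_C k U (f * g).
Proof.
move=> oU; elim: k f g => [|k IH] f g Cf Cg.
  split=> // x Ux; apply: cvgM; [exact: Cf.1 | exact: Cg.1].
split=> [x Ux|v].
  apply: cvgM; [exact: Cf.1 | exact: Cg.1].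
have [dfv dfC] := Cf.2 v; have [dgv dgC] := Cg.2 v; split=> [x Ux|].
  by apply: derivableM; [exact: dfv | exact: dgv].
have C1 := IH _ _ (class_CS Cf) dgC.
have C2 := class_CB oU (class_C_cst k 0 oU) (IH _ _ (class_CS Cg) dfC).
apply: class_C_ext (class_CB oU C1 C2) => // x Ux.
rewrite deriveM; [|exact: dfv|exact: dgv].
by rewrite !fctE sub0r opprK.
Qed.

(* [param] is the inverse of [coord] on the open set [coord @` dom]. *)
Record chart (R : realType) (n : nat) (T : topologicalType) := Chart {
  dom : set T;
  coord : T -> 'rV[R]_n;
  param : 'rV[R]_n -> T;
  dom_open : open dom;
  coord_open : open (coord @` dom);
  coordK : forall x, dom x -> param (coord x) = x;
  coord_continuous : forall x, dom x -> {for x, continuous coord};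
  param_continuous :
    forall u, (coord @` dom) u -> {for u, continuous param}
}.

Arguments coord_open {R n T} c.

(* The atlas need not be maximal. *)
Record smooth_structure (R : realType) (n : nat) (T : topologicalType) :=
  SmoothStructure {
  atlas : set (chart R n T);
  atlas_cover : forall x, exists2 c, atlas c & dom c x;
  atlas_compat : forall c d, atlas c -> atlas d ->
    smooth_on (coord c @` (dom c `&` dom d)) (coord d \o param c);
  manifold_hausdorff : hausdorff_space T;
  manifold_second_countable : @second_countable T
}.

#[short(type="topGroupType")]
HB.structure Definition TopGroup := {T of Group T & Topological T}.

Record lie_group (R : realType) (n : nat) := LieGroup {
  lsort :> topGroupType;
  lsmooth : smooth_structure R n lsort;
  lmul_continuous : continuous (fun p : lsort * lsort => (p.1 * p.2)%g);
  linv_continuous : continuous (fun x : lsort => (x^-1)%g);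
  lmul_smooth : forall c d e : chart R n lsort,
    atlas lsmooth c -> atlas lsmooth d -> atlas lsmooth e ->
    smooth_on
      [set u : 'rV[R]_n * 'rV[R]_n | [/\ (coord c @` dom c) u.1,
         (coord d @` dom d) u.2 & dom e (param c u.1 * param d u.2)%g]]
      (fun u => coord e (param c u.1 * param d u.2)%g);
  linv_smooth : forall c d : chart R n lsort,
    atlas lsmooth c -> atlas lsmooth d ->
    smooth_on
      [set u : 'rV[R]_n | (coord c @` dom c) u /\ dom d ((param c u)^-1)%g]
      (fun u => coord d ((param c u)^-1)%g)
}.

(* Every loop is null-homotopic (relative to its base point). *)
Definition simply_connected (R : realType) (T : topologicalType) :=
  connected [set: T] /\
  forall gamma : R -> T, {within `[0, 1], continuous gamma} ->
    gamma 0 = gamma 1 ->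
    exists H : R * R -> T,
      [/\ {within `[0, 1] `*` `[0, 1], continuous H},
          forall t, t \in `[0, 1] -> H (0, t) = gamma t,
          forall t, t \in `[0, 1] -> H (1, t) = gamma 0 &
          forall s, s \in `[0, 1] -> H (s, 0) = gamma 0 /\ H (s, 1) = gamma 0].

Section SmoothFunctions.
Context {R : realType} {n : nat} (G : lie_group R n).

Definition smooth_fun : {pred G -> R} := fun f =>
  `[< forall c, atlas (lsmooth G) c ->
        smooth_on (coord c @` dom c) (f \o param c) >].

Lemma smooth_fun_subring : subring_closed smooth_fun.
Proof.
split=> [|f g /asboolP Sf /asboolP Sg|f g /asboolP Sf /asboolP Sg];
  apply/asboolP => c Ac k.
- exact: (class_C_cst k (1 : R) (coord_open c)).
- exact: (class_CB (coord_open c) (Sf c Ac k) (Sg c Ac k)).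
- exact: (class_CM (coord_open c) (Sf c Ac k) (Sg c Ac k)).
Qed.

HB.instance Definition _ :=
  GRing.isSubringClosed.Build (G -> R) smooth_fun smooth_fun_subring.

Record Cinf := MkCinf {
  Cinf_fun :> G -> R;
  Cinf_smooth : Cinf_fun \in smooth_fun
}.

HB.instance Definition _ := [isSub for Cinf_fun].
HB.instance Definition _ := [Choice of Cinf by <:].
HB.instance Definition _ :=
  GRing.SubChoice_isSubComPzRing.Build (G -> R) smooth_fun Cinf
    smooth_fun_subring.

Lemma Cinf_oner_neq0 : (1 : Cinf) != 0.
Proof.
apply/eqP => /(congr1 (fun f : Cinf => f 1%g)) /eqP.
by rewrite (oner_eq0 R).
Qed.

HB.instance Definition _ :=
  GRing.PzSemiRing_isNonZero.Build Cinf Cinf_oner_neq0.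

Lemma cst_smooth (a : R) : (cst a : G -> R) \in smooth_fun.
Proof. by apply/asboolP => c _ k; exact: (class_C_cst k a (coord_open c)). Qed.

Definition Ccst (a : R) : Cinf := MkCinf (cst_smooth a).

(* Vector fields on [G] are encoded as the [R]-linear derivations of the algebra
   of smooth functions; they form a module over that algebra. *)
Definition derivation : {pred Cinf -> Cinf^o} := fun X =>
  `[< (forall (a : R) (f h : Cinf), X (Ccst a * f + h) = Ccst a * X f + X h) /\
      (forall f h : Cinf, X (f * h) = f * X h + X f * h) >].

Lemma derivation_submod : submod_closed derivation.
Proof.
split=> [|/= k X Y /asboolP[lX dX] /asboolP[lY dY]]; apply/asboolP; split.
- move=> a f h; change ((0 : Cinf) = Ccst a * 0 + 0); ring.
- move=> f h; change ((0 : Cinf) = f * 0 + 0 * h); ring.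
- move=> a f h; change (k * X (Ccst a * f + h) + Y (Ccst a * f + h) =
    Ccst a * (k * X f + Y f) + (k * X h + Y h)); rewrite lX lY; ring.
- move=> f h; change (k * X (f * h) + Y (f * h) =
    f * (k * X h + Y h) + (k * X f + Y f) * h); rewrite dX dY; ring.
Qed.

HB.instance Definition _ :=
  GRing.isSubmodClosed.Build Cinf (Cinf -> Cinf^o) derivation derivation_submod.

Record vfield := MkVfield {
  vfield_val : Cinf -> Cinf^o;
  vfield_derivation : vfield_val \in derivation
}.

HB.instance Definition _ := [isSub for vfield_val].
HB.instance Definition _ := [Choice of vfield by <:].
HB.instance Definition _ := [SubChoice_isSubLmodule of vfield by <:].

Definition vfield_app (X : vfield) : Cinf -> Cinf := vfield_val X.
Coercion vfield_app : vfield >-> Funclass.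

Lemma vfield_linear (X : vfield) (a : R) (f h : Cinf) :
  X (Ccst a * f + h) = Ccst a * X f + X h.
Proof. by have /asboolP[lX _] := vfield_derivation X; exact: lX. Qed.

Lemma vfieldM (X : vfield) (f h : Cinf) : X (f * h) = f * X h + X f * h.
Proof. by have /asboolP[_ dX] := vfield_derivation X; exact: dX. Qed.

Lemma Ccst1 : Ccst 1 = 1.
Proof. exact: val_inj. Qed.

Lemma vfieldD (X : vfield) (f h : Cinf) : X (f + h) = X f + X h.
Proof. by have := vfield_linear X 1 f h; rewrite Ccst1 !mul1r. Qed.

Lemma bracket_derivation (X Y : vfield) :
  (fun f => X (Y f) - Y (X f)) \in derivation.
Proof.
apply/asboolP; split=> [a f h|f h].
  by rewrite !vfield_linear; ring.
by rewrite !vfieldM !vfieldD !vfieldM; ring.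
Qed.

Definition bracket (X Y : vfield) : vfield := MkVfield (bracket_derivation X Y).

End SmoothFunctions.

Section LeftInvariance.
Context {R : realType} (G : lie_group R 3).
Implicit Types (X Y Z e : vfield G) (g : vfield G -> vfield G -> Cinf G).

(* [h] is the smooth function [fun x => f (a * x)]; hence [X'] is the push-forward
   of [X] by the left translation [x |-> a * x]. *)
Definition left_translate (a : G) X X' :=
  forall f h : Cinf G, (forall x, h x = f (a * x)%g) ->
    forall x, X h x = X' f (a * x)%g.

Definition left_invariant X := forall a : G, left_translate a X X.

Definition lie_algebra_basis e1 e2 e3 :=
  [/\ left_invariant e1, left_invariant e2, left_invariant e3 &
      forall X, left_invariant X ->
        exists! a : R * R * R,
          X = Ccst G a.1.1 *: e1 + Ccst G a.1.2 *: e2 + Ccst G a.2 *: e3].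

Definition pseudo_orthonormal g e1 e2 e3 :=
  [/\ g e1 e1 = 1, g e2 e2 = 1 & g e3 e3 = -1] /\
  [/\ g e1 e2 = 0, g e1 e3 = 0 & g e2 e3 = 0].

(* The [C^oo(G)]-bilinear symmetric form [g] is a metric of signature (+,+,-):
   each tangent space (the values at [x] of the vector fields) has a
   pseudo-orthonormal basis. *)
Definition lorentzian_metric g :=
  [/\ forall X Y, g X Y = g Y X,
      forall (f : Cinf G) X Y Z, g (f *: X + Y) Z = f * g X Z + g Y Z &
      forall x : G, exists E1 E2 E3 : vfield G,
        [/\ [/\ g E1 E1 x = 1, g E2 E2 x = 1 & g E3 E3 x = -1],
            [/\ g E1 E2 x = 0, g E1 E3 x = 0 & g E2 E3 x = 0] &
            forall Y, exists a b c : R, forall f : Cinf G,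
              Y f x = a * E1 f x + b * E2 f x + c * E3 f x]].

Definition left_invariant_metric g :=
  forall (a : G) X X' Y Y', left_translate a X X' -> left_translate a Y Y' ->
    forall x, g X Y x = g X' Y' (a * x)%g.

End LeftInvariance.

Section Connections.
Context {R : realType} {n : nat} {G : lie_group R n}.
Implicit Types (X Y Z : vfield G) (g omega : vfield G -> vfield G -> Cinf G).
Implicit Types (nabla nablaL nablaB : vfield G -> vfield G -> vfield G).
Implicit Types D E : set (vfield G).

Definition linear_connection nabla :=
  [/\ forall (f : Cinf G) X Y Z,
        nabla (f *: X + Y) Z = f *: nabla X Z + nabla Y Z,
      forall X Y Z, nabla X (Y + Z) = nabla X Y + nabla X Z &
      forall (f : Cinf G) X Y, nabla X (f *: Y) = X f *: Y + f *: nabla X Y].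

Definition levi_civita g nabla :=
  [/\ linear_connection nabla,
      forall X Y, nabla X Y - nabla Y X = bracket X Y &
      forall X Y Z, X (g Y Z) = g (nabla X Y) Z + g Y (nabla X Z)].

(* Sections of the distribution spanned by one, resp. two, vector fields. *)
Definition span1 X : set (vfield G) :=
  [set Z | exists a : Cinf G, Z = a *: X].

Definition span2 X Y : set (vfield G) :=
  [set Z | exists a b : Cinf G, Z = a *: X + b *: Y].

(* [TG] is the direct sum of [D] and [E], with projections [p] and [p']. *)
Definition splitting D E (p p' : vfield G -> vfield G) :=
  D `&` E = [set 0] /\
  forall X, [/\ D (p X), E (p' X) & X = p X + p' X].

Definition bott_connection D E (p p' : vfield G -> vfield G) nablaL nablaB :=
  linear_connection nablaB /\
  [/\ forall X Y, D X -> D Y -> nablaB X Y = p (nablaL X Y),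
      forall X Y, E X -> D Y -> nablaB X Y = p (bracket X Y),
      forall X Y, D X -> E Y -> nablaB X Y = p' (bracket X Y) &
      forall X Y, E X -> E Y -> nablaB X Y = p' (nablaL X Y)].

Definition curvature nabla X Y Z :=
  nabla X (nabla Y Z) - nabla Y (nabla X Z) - nabla (bracket X Y) Z.

Definition ricci g nabla (e1 e2 e3 : vfield G) X Y : Cinf G :=
  - g (curvature nabla X e1 Y) e1 - g (curvature nabla X e2 Y) e2
  + g (curvature nabla X e3 Y) e3.

Definition sym_ricci g nabla (e1 e2 e3 : vfield G) X Y : Cinf G :=
  Ccst G 2^-1 * (ricci g nabla e1 e2 e3 X Y + ricci g nabla e1 e2 e3 Y X).

Definition covariant_derivative nabla omega X Y Z : Cinf G :=
  X (omega Y Z) - omega (nabla X Y) Z - omega Y (nabla X Z).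

Definition codazzi nabla omega :=
  forall X Y Z, covariant_derivative nabla omega X Y Z
                - covariant_derivative nabla omega Y X Z = 0.

End Connections.

(* Main.v *)
Require Import Defs.
From HB Require Import structures.
From mathcomp Require Import all_boot all_order all_algebra.
From mathcomp Require Import all_classical all_reals all_analysis.
From mathcomp Require Import ring.
Import Order.TTheory GRing.Theory Num.Theory.
Import numFieldNormedType.Exports.
Local Open Scope classical_set_scope.
Local Open Scope ring_scope.

(** Everything happens on the left-invariant fields, that is, on the
    combinations [frame e1 e2 e3 a b c] of the basis with real coefficients.
    These fields are closed under the bracket ([bracket_frame]) and under the
    Bott connection ([bott_frame]), and [g] is constant on them
    ([metric_frame]).  Hence on them the curvature, the Ricci tensor and its
    covariant derivative are polynomials in the coefficients, and the
    derivative [X (omega Y Z)] in the definition of a Codazzi tensor vanishes.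

    The Bott connection is determined on the frame by its four defining cases.
    The two mixed cases are projections of brackets.  In the other two the
    Levi-Civita connection enters only through inner products with the frame,
    because the splitting is orthogonal ([splitting_coord]); the Koszul
    formula [koszul] gives these inner products.  Writing [nabla_i] for
    [nablaB e_i], the non-zero values are
      nabla_1 e1 = - alpha e2,              nabla_1 e2 = alpha e1,
      nabla_2 e3 = alpha e3,
      nabla_3 e1 = alpha e1 + beta e2,      nabla_3 e2 = - beta e1 - alpha e2.

    The symmetrized Ricci tensor s then has s_11 = s_22 = - (alpha^2 + beta^2),
    s_12 = alpha beta, s_13 = - alpha beta / 2, s_23 = alpha^2 / 2, s_33 = 0.
    Evaluating the Codazzi condition at (e1, e3, e1) gives
      alpha s_23 + 2 (alpha s_11 + beta s_12) = - 3/2 alpha^3,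
    where the powers of beta cancel.  This constant is not zero, whatever beta
    is ([bott_codazzi_defect]). *)

(** * Constants and real-bilinear operations *)

Lemma addr_idem0 (V : zmodType) (x : V) : x = x + x -> x = 0.
Proof. by move=> /esym/(canRL (addrK _)); rewrite subrr. Qed.

Section Constants.
Context {R : realType} {n : nat} (G : lie_group R n).
Implicit Types (a b : R) (f : Cinf G) (X Y Z : vfield G).

Lemma Ccst0 : Ccst G 0 = 0.
Proof. exact: val_inj. Qed.

Lemma CcstD a b : Ccst G (a + b) = Ccst G a + Ccst G b.
Proof. exact: val_inj. Qed.

Lemma CcstN a : Ccst G (- a) = - Ccst G a.
Proof. exact: val_inj. Qed.

Lemma CcstM a b : Ccst G (a * b) = Ccst G a * Ccst G b.
Proof. exact: val_inj. Qed.

(** The underlying group is inhabited by its unit, so a constant function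
    determines its value. *)
Lemma Ccst_inj : injective (Ccst G).
Proof. by move=> a b /(congr1 (fun f : Cinf G => f 1%g)). Qed.

Lemma double_Ccst f a : f + f = Ccst G (a + a) -> f = Ccst G a.
Proof.
move=> ff; have half : Ccst G 2^-1 + Ccst G 2^-1 = 1.
  by rewrite -CcstD -Ccst1; congr Ccst; field.
rewrite -[f]mul1r -[Ccst G a]mul1r -half mulrDl -mulrDr ff CcstD.
by rewrite mulrDr mulrDl.
Qed.

(** The Leibniz rule at [1 * 1] gives [X 1 = X 1 + X 1]; constants are real
    multiples of [1]. *)
Lemma vfield_Ccst X a : X (Ccst G a) = 0.
Proof.
have X1 : X 1 = 0.
  by apply: addr_idem0; have := vfieldM X 1 1; rewrite mulr1 !mul1r mulr1.
have X0 : X 0 = 0.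
  by apply: addr_idem0; have := vfieldD X 0 0; rewrite addr0.
by have := vfield_linear X a 1 0; rewrite mulr1 addr0 X1 X0 mulr0 addr0.
Qed.

Lemma vfieldP X Y : (forall f, X f = Y f) -> X = Y.
Proof. by move=> XY; apply: val_inj; apply/funext => f; exact: XY. Qed.

Lemma bracketC X Y : bracket Y X = - bracket X Y.
Proof.
apply: vfieldP => f.
change (Y (X f) - X (Y f) = - (X (Y f) - Y (X f))).
by rewrite opprB.
Qed.

Lemma bracketxx X : bracket X X = 0.
Proof.
apply: vfieldP => f; change (X (X f) - X (X f) = 0).
by rewrite subrr.
Qed.

(** The common property of brackets and connections that allows them to be
    computed on the left-invariant fields: neither is bilinear over the smooth
    functions, but the correcting terms differentiate the coefficients. *)
Definition real_bilinear (op : vfield G -> vfield G -> vfield G) :=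
  [/\ forall X Y Z, op (X + Y) Z = op X Z + op Y Z,
      forall X Y Z, op X (Y + Z) = op X Y + op X Z,
      forall a X Y, op (Ccst G a *: X) Y = Ccst G a *: op X Y &
      forall a X Y, op X (Ccst G a *: Y) = Ccst G a *: op X Y].

Lemma bracket_real_bilinear : real_bilinear (@bracket R n G).
Proof.
have bD X Y Z : bracket (X + Y) Z = bracket X Z + bracket Y Z.
  apply: vfieldP => f.
  change (X (Z f) + Y (Z f) - Z (X f + Y f) =
          X (Z f) - Z (X f) + (Y (Z f) - Z (Y f))).
  by rewrite vfieldD; ring.
have bZ a X Y : bracket (Ccst G a *: X) Y = Ccst G a *: bracket X Y.
  apply: vfieldP => f.
  change (Ccst G a * X (Y f) - Y (Ccst G a * X f) =
          Ccst G a * (X (Y f) - Y (X f))).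
  by rewrite vfieldM vfield_Ccst; ring.
split=> // [X Y Z|a X Y].
  by rewrite bracketC bD (bracketC X Y) (bracketC X Z) opprD !opprK.
by rewrite bracketC bZ (bracketC X Y) scalerN opprK.
Qed.

Lemma connection_real_bilinear {nabla} :
  linear_connection nabla -> real_bilinear nabla.
Proof.
move=> [nl nD nZ]; have n0 Z : nabla 0 Z = 0.
  by apply: addr_idem0; have := nl 1 0 0 Z; rewrite !scale1r addr0.
split=> // [X Y Z|a X Y|a X Y].
- by have := nl 1 X Y Z; rewrite !scale1r.
- by have := nl (Ccst G a) X 0 Y; rewrite n0 !addr0.
- by rewrite nZ vfield_Ccst scale0r add0r.
Qed.

End Constants.

Arguments connection_real_bilinear {R n G nabla}.
Arguments bracketC {R n G} X Y.
Arguments real_bilinear {R n G} op.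

(** * Metrics and the Koszul formula *)

Section Metric.
Context {R : realType} {G : lie_group R 3}.
Context {g : vfield G -> vfield G -> Cinf G}.
Implicit Types (f : Cinf G) (X Y Z : vfield G).
Context (g_lorentzian : lorentzian_metric g).

Lemma metricC X Y : g X Y = g Y X.
Proof. by case: g_lorentzian. Qed.

Lemma metricDl X Y Z : g (X + Y) Z = g X Z + g Y Z.
Proof.
by case: g_lorentzian => _ gl _; have := gl 1 X Y Z; rewrite scale1r mul1r.
Qed.

Lemma metricZl f X Y : g (f *: X) Y = f * g X Y.
Proof.
have g0 : g 0 Y = 0.
  by apply: addr_idem0; have := metricDl 0 0 Y; rewrite addr0.
by case: g_lorentzian => _ gl _; have := gl f X 0 Y; rewrite g0 !addr0.
Qed.

Lemma metricNl X Y : g (- X) Y = - g X Y.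
Proof. by rewrite -scaleN1r metricZl mulN1r. Qed.

Lemma metricDr X Y Z : g X (Y + Z) = g X Y + g X Z.
Proof. by rewrite metricC metricDl !(metricC X). Qed.

Lemma metricZr f X Y : g X (f *: Y) = f * g X Y.
Proof. by rewrite metricC metricZl (metricC X). Qed.

(** The right-hand side is expanded by metric compatibility and by the absence
    of torsion; everything but two copies of [g (nabla X Y) Z] cancels. *)
Lemma koszul {nabla X Y Z} : levi_civita g nabla ->
  g (nabla X Y) Z + g (nabla X Y) Z =
    X (g Y Z) + Y (g X Z) - Z (g X Y)
    + g (bracket X Y) Z - g (bracket X Z) Y - g (bracket Y Z) X.
Proof.
move=> [_ tors compat].
rewrite -!tors !compat !(metricDl, metricNl).
rewrite (metricC X (nabla Y Z)) (metricC Y (nabla X Z)) (metricC X (nabla Z Y)).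
ring.
Qed.

End Metric.

(** * Calculus in a frame *)

Lemma addr3ACA (V : nmodType) (u1 u2 u3 v1 v2 v3 : V) :
  u1 + u2 + u3 + (v1 + v2 + v3) = (u1 + v1) + (u2 + v2) + (u3 + v3).
Proof. by rewrite addrACA; congr (_ + _); rewrite addrACA. Qed.

(** Locked, because the unifier would otherwise unfold it into sums of vector
    fields, and then further into sums of derivations, when it rewrites with the
    laws below. *)
HB.lock Definition frame (R : realType) (n : nat) (G : lie_group R n)
    (e1 e2 e3 : vfield G) (a b c : R) : vfield G :=
  Ccst G a *: e1 + Ccst G b *: e2 + Ccst G c *: e3.

Arguments frame {R n G} e1 e2 e3 a b c.

Section Frame.
Context {R : realType} {n : nat} {G : lie_group R n} (e1 e2 e3 : vfield G).
Implicit Types (a b c x y z : R).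

Local Notation F := (frame e1 e2 e3).

Lemma frameE a b c :
  F a b c = Ccst G a *: e1 + Ccst G b *: e2 + Ccst G c *: e3.
Proof. by rewrite unlock. Qed.

Lemma frame_e1 : e1 = F 1 0 0.
Proof. by rewrite !frameE Ccst1 Ccst0 scale1r !scale0r !addr0. Qed.

Lemma frame_e2 : e2 = F 0 1 0.
Proof. by rewrite !frameE Ccst1 Ccst0 scale1r !scale0r add0r addr0. Qed.

Lemma frame_e3 : e3 = F 0 0 1.
Proof. by rewrite !frameE Ccst1 Ccst0 scale1r !scale0r !add0r. Qed.

Lemma frameD a b c x y z :
  F a b c + F x y z = F (a + x) (b + y) (c + z).
Proof. by rewrite !frameE !CcstD !scalerDl addr3ACA. Qed.

Lemma frameZ a x y z : Ccst G a *: F x y z = F (a * x) (a * y) (a * z).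
Proof. by rewrite !frameE !CcstM !scalerDr !scalerA. Qed.

Lemma frameN x y z : - F x y z = F (- x) (- y) (- z).
Proof. by rewrite !frameE !CcstN !scaleNr !opprD. Qed.

Lemma real_bilinear_frame {op a b c x y z} : real_bilinear op ->
  op (F a b c) (F x y z) =
    Ccst G a *:
      (Ccst G x *: op e1 e1 + Ccst G y *: op e1 e2 + Ccst G z *: op e1 e3)
  + Ccst G b *:
      (Ccst G x *: op e2 e1 + Ccst G y *: op e2 e2 + Ccst G z *: op e2 e3)
  + Ccst G c *:
      (Ccst G x *: op e3 e1 + Ccst G y *: op e3 e2 + Ccst G z *: op e3 e3).
Proof.
by move=> [opDl opDr opZl opZr]; rewrite !frameE !opDl !opZl !opDr !opZr.
Qed.

End Frame.

Arguments real_bilinear_frame {R n G e1 e2 e3 op a b c x y z}.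

Section OrthonormalFrame.
Context {R : realType} {G : lie_group R 3} {e1 e2 e3 : vfield G}.
Context {g : vfield G -> vfield G -> Cinf G}.
Context (g_lorentzian : lorentzian_metric g).
Context (orthonormal : pseudo_orthonormal g e1 e2 e3).

Lemma metric_frame a b c x y z :
  g (frame e1 e2 e3 a b c) (frame e1 e2 e3 x y z) =
  Ccst G (a * x + b * y - c * z).
Proof.
have [[g11 g22 g33] [g12 g13 g23]] := orthonormal.
have gC := metricC g_lorentzian.
rewrite !frameE !(metricDl g_lorentzian, metricZl g_lorentzian).
rewrite !(metricDr g_lorentzian, metricZr g_lorentzian).
rewrite (gC e2 e1) (gC e3 e1) (gC e3 e2) g11 g22 g33 g12 g13 g23.
by rewrite !(CcstD, CcstN, CcstM); ring.
Qed.

Context {p p' : vfield G -> vfield G}.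
Context (split : splitting (span2 e1 e2) (span1 e3) p p').

(** The projections are unspecified functions, but the decomposition of a field
    along complementary distributions is unique. *)
Lemma splitting_frame a b c :
  p (frame e1 e2 e3 a b c) = frame e1 e2 e3 a b 0 /\
  p' (frame e1 e2 e3 a b c) = frame e1 e2 e3 0 0 c.
Proof.
have [DE0 pp'] := split.
have [[u [v pE]] [w p'E] XE] := pp' (frame e1 e2 e3 a b c).
set X := frame e1 e2 e3 a b c in pE p'E XE *.
(* A section of both distributions, hence zero. *)
have dE : p X - frame e1 e2 e3 a b 0 = frame e1 e2 e3 0 0 c - p' X.
  rewrite -[p X](addrK (p' X)) -XE addrAC; congr (_ - _).
  by rewrite frameN frameD !subrr subr0.
have d0 : p X - frame e1 e2 e3 a b 0 = 0.
  suff : [set 0] (p X - frame e1 e2 e3 a b 0) by [].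
  rewrite -DE0; split; last first.
    exists (Ccst G c - w); rewrite dE p'E !frameE Ccst0 !scale0r !add0r.
    by rewrite scalerBl.
  exists (u - Ccst G a), (v - Ccst G b); rewrite pE !frameE Ccst0 scale0r addr0.
  by rewrite !scalerBl opprD addrACA.
by split; apply/eqP; rewrite -subr_eq0 ?d0// -oppr_eq0 opprB -dE d0.
Qed.

(** The splitting is orthogonal, so the coordinates of a projection are inner
    products; the sign on [e3] comes from [g e3 e3 = -1]. This computes a
    projection of [nablaL X Y] without knowing that field itself. *)
Lemma splitting_coord V : p V = g V e1 *: e1 + g V e2 *: e2 /\
  p' V = - g V e3 *: e3.
Proof.
have [_ /(_ V)[[u [v pE]] [w p'E] VE]] := split.
have [[g11 g22 g33] [g12 g13 g23]] := orthonormal.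
have gC := metricC g_lorentzian.
have gV W : g V W = u * g e1 W + v * g e2 W + w * g e3 W.
  by rewrite VE pE p'E !(metricDl g_lorentzian, metricZl g_lorentzian).
rewrite pE p'E !gV (gC e2 e1) (gC e3 e1) (gC e3 e2) g11 g22 g33 g12 g13 g23.
by rewrite !mulr0 !mulr1 !addr0 !add0r mulrN1 opprK.
Qed.

End OrthonormalFrame.

(** * The Bott connection of the Lie algebra *)

Section BottConnection.
Context {R : realType} {alpha beta : R} {G : lie_group R 3}.
Context {e1 e2 e3 : vfield G} {g : vfield G -> vfield G -> Cinf G}.
Context {nablaL nablaB : vfield G -> vfield G -> vfield G}.
Context {piD piDperp : vfield G -> vfield G}.
Context (e12 : bracket e1 e2 = Ccst G alpha *: e1 - Ccst G beta *: e3).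
Context (e13 : bracket e1 e3 = - (Ccst G alpha *: e1) - Ccst G beta *: e2).
Context (e23 : bracket e2 e3 =
  Ccst G beta *: e1 + Ccst G alpha *: e2 + Ccst G alpha *: e3).
Context (g_lorentzian : lorentzian_metric g).
Context (orthonormal : pseudo_orthonormal g e1 e2 e3).
Context (nablaL_levi_civita : levi_civita g nablaL).
Context (split : splitting (span2 e1 e2) (span1 e3) piD piDperp).
Context (nablaB_bott :
  bott_connection (span2 e1 e2) (span1 e3) piD piDperp nablaL nablaB).

Implicit Types (a b c x y z u v : R).

Local Notation F := (frame e1 e2 e3).

Lemma bracket_frame a b c x y z :
  let w12 := a * y - b * x in let w13 := a * z - c * x in
  let w23 := b * z - c * y in
  bracket (F a b c) (F x y z) =
    F (alpha * w12 - alpha * w13 + beta * w23) (- beta * w13 + alpha * w23)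
      (- beta * w12 + alpha * w23).
Proof.
have b12 : bracket e1 e2 = F alpha 0 (- beta).
  by rewrite e12 !frameE Ccst0 scale0r addr0 CcstN scaleNr.
have b13 : bracket e1 e3 = F (- alpha) (- beta) 0.
  by rewrite e13 !frameE Ccst0 scale0r addr0 !CcstN !scaleNr.
have b23 : bracket e2 e3 = F beta alpha alpha by rewrite frameE; exact: e23.
have b0 : (0 : vfield G) = F 0 0 0 by rewrite !frameE Ccst0 !scale0r !addr0.
rewrite /= (real_bilinear_frame (bracket_real_bilinear G)) !bracketxx.
rewrite (bracketC e1 e2) (bracketC e1 e3) (bracketC e2 e3) b12 b13 b23 b0.
by rewrite !(frameN, frameZ, frameD); congr (F _ _ _); ring.
Qed.

(** Between fields tangent to the plane of [e1] and [e2], the Bott connection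
    sees of [nablaL] only its tangential part, hence the vanishing third
    coefficient in all three arguments. *)
Lemma levi_civita_D a b x y u v :
  g (nablaL (F a b 0) (F x y 0)) (F u v 0) =
  Ccst G (alpha * a * (u * y - v * x)).
Proof.
apply: double_Ccst; rewrite (koszul g_lorentzian nablaL_levi_civita).
rewrite !bracket_frame !(metric_frame g_lorentzian orthonormal) !vfield_Ccst.
by rewrite !(CcstD, CcstN, CcstM, Ccst0); ring.
Qed.

Lemma levi_civita_Dperp a b c :
  g (nablaL (F 0 0 a) (F 0 0 b)) (F 0 0 c) = Ccst G 0.
Proof.
apply: double_Ccst; rewrite (koszul g_lorentzian nablaL_levi_civita).
rewrite !bracket_frame !(metric_frame g_lorentzian orthonormal) !vfield_Ccst.
by rewrite !(CcstD, CcstN, CcstM, Ccst0); ring.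
Qed.

Lemma span2_frame a b : span2 e1 e2 (F a b 0).
Proof.
by exists (Ccst G a), (Ccst G b); rewrite !frameE Ccst0 scale0r addr0.
Qed.

Lemma span1_frame c : span1 e3 (F 0 0 c).
Proof. by exists (Ccst G c); rewrite !frameE Ccst0 !scale0r !add0r. Qed.

Lemma bott_D_D a b x y :
  nablaB (F a b 0) (F x y 0) = F (alpha * a * y) (- (alpha * a * x)) 0.
Proof.
have [_ [nDD _ _ _]] := nablaB_bott.
rewrite nDD; [|exact: span2_frame|exact: span2_frame].
rewrite (splitting_coord g_lorentzian orthonormal split _).1.
rewrite [X in g _ X *: e1](frame_e1 e1 e2 e3).
rewrite [X in g _ X *: e2](frame_e2 e1 e2 e3) !levi_civita_D.
rewrite [RHS]frameE Ccst0 scale0r addr0.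
by rewrite !mul1r !mul0r subr0 sub0r mulrN.
Qed.

Lemma bott_Dperp_D c x y :
  nablaB (F 0 0 c) (F x y 0) =
  F (alpha * c * x - beta * c * y) (beta * c * x - alpha * c * y) 0.
Proof.
have [_ [_ nED _ _]] := nablaB_bott.
rewrite nED; [|exact: span1_frame|exact: span2_frame].
rewrite bracket_frame (splitting_frame split _ _ _).1.
by congr (F _ _ _); ring.
Qed.

Lemma bott_D_Dperp a b z :
  nablaB (F a b 0) (F 0 0 z) = F 0 0 (alpha * b * z).
Proof.
have [_ [_ _ nDE _]] := nablaB_bott.
rewrite nDE; [|exact: span2_frame|exact: span1_frame].
rewrite bracket_frame (splitting_frame split _ _ _).2.
by congr (F _ _ _); ring.
Qed.

Lemma bott_Dperp_Dperp c z : nablaB (F 0 0 c) (F 0 0 z) = F 0 0 0.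
Proof.
have [_ [_ _ _ nEE]] := nablaB_bott.
rewrite nEE; [|exact: span1_frame|exact: span1_frame].
rewrite (splitting_coord g_lorentzian orthonormal split _).2.
rewrite [X in g _ X](frame_e3 e1 e2 e3) levi_civita_Dperp.
by rewrite !frameE Ccst0 oppr0 !scale0r !addr0.
Qed.

(** Splitting both arguments along the two distributions leaves one term for
    each of the four defining cases. *)
Lemma bott_frame a b c x y z :
  nablaB (F a b c) (F x y z) =
  F (alpha * a * y + alpha * c * x - beta * c * y)
    (- (alpha * a * x) + beta * c * x - alpha * c * y)
    (alpha * b * z).
Proof.
have [nB _] := nablaB_bott.
have [nDl nDr _ _] := connection_real_bilinear nB.
have FE u v w : F u v w = F u v 0 + F 0 0 w.
  by rewrite frameD !(addr0, add0r).
rewrite (FE a) (FE x) nDl !nDr bott_D_D bott_Dperp_D bott_D_Dperp.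
by rewrite bott_Dperp_Dperp !frameD; congr (F _ _ _); ring.
Qed.

Lemma bott_ricci_frame a b c x y z :
  ricci g nablaB e1 e2 e3 (F a b c) (F x y z) =
  Ccst G (- (alpha ^+ 2 + beta ^+ 2) * (a * x + b * y)
          + alpha * beta * (a * y + b * x - a * z) + alpha ^+ 2 * (b * z)).
Proof.
have -> : ricci g nablaB e1 e2 e3 =
    ricci g nablaB (F 1 0 0) (F 0 1 0) (F 0 0 1).
  by rewrite -(frame_e1 e1 e2 e3) -(frame_e2 e1 e2 e3) -(frame_e3 e1 e2 e3).
rewrite /ricci /curvature !bracket_frame !bott_frame !(frameN, frameD).
rewrite !(metric_frame g_lorentzian orthonormal) -!(CcstN, CcstD).
by congr Ccst; ring.
Qed.

Lemma bott_sym_ricci_frame a b c x y z :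
  sym_ricci g nablaB e1 e2 e3 (F a b c) (F x y z) =
  Ccst G (- (alpha ^+ 2 + beta ^+ 2) * (a * x + b * y)
          + alpha * beta * (a * y + b * x)
          - alpha * beta / 2 * (a * z + c * x)
          + alpha ^+ 2 / 2 * (b * z + c * y)).
Proof.
rewrite /sym_ricci !bott_ricci_frame -CcstD -CcstM.
by congr Ccst; field.
Qed.

(** The components [s e1 e1] and [s e1 e2] enter through [nablaB e3 e1], and
    [s e2 e3] through [nablaB e1 e1]; the terms in [alpha * beta ^+ 2] cancel
    between the first two, so that what remains does not involve [beta]. *)
Lemma bott_codazzi_defect :
  let s := sym_ricci g nablaB e1 e2 e3 in
  covariant_derivative nablaB s e1 e3 e1
  - covariant_derivative nablaB s e3 e1 e1 = Ccst G (- (3 / 2) * alpha ^+ 3).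
Proof.
move=> s; pose cd X Y Z := covariant_derivative nablaB s X Y Z
                          - covariant_derivative nablaB s Y X Z.
rewrite -/(cd e1 e3 e1).
have -> : cd e1 e3 e1 = cd (F 1 0 0) (F 0 0 1) (F 1 0 0).
  by rewrite -(frame_e1 e1 e2 e3) -(frame_e3 e1 e2 e3).
rewrite /cd /covariant_derivative !bott_frame /s !bott_sym_ricci_frame.
rewrite !vfield_Ccst -(Ccst0 G) -!(CcstN, CcstD).
by congr Ccst; field.
Qed.

End BottConnection.

Theorem theorem2p4 (R : realType) (alpha beta : R) (G : lie_group R 3)
    (e1 e2 e3 : vfield G) (g : vfield G -> vfield G -> Cinf G)
    (nablaL nablaB : vfield G -> vfield G -> vfield G)
    (piD piDperp : vfield G -> vfield G)
    (alpha_neq0 : alpha != 0)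
    (G_simply_connected : simply_connected R G)
    (e_basis : lie_algebra_basis e1 e2 e3)
    (e12 : bracket e1 e2 = Ccst G alpha *: e1 - Ccst G beta *: e3)
    (e13 : bracket e1 e3 = - (Ccst G alpha *: e1) - Ccst G beta *: e2)
    (e23 : bracket e2 e3 =
       Ccst G beta *: e1 + Ccst G alpha *: e2 + Ccst G alpha *: e3)
    (g_lorentzian : lorentzian_metric g)
    (g_left_invariant : left_invariant_metric g)
    (e_pseudo_orthonormal : pseudo_orthonormal g e1 e2 e3)
    (nablaL_levi_civita : levi_civita g nablaL)
    (TG_splitting : splitting (span2 e1 e2) (span1 e3) piD piDperp)
    (nablaB_bott :
       bott_connection (span2 e1 e2) (span1 e3) piD piDperp nablaL nablaB) :
  ~ codazzi nablaB (sym_ricci g nablaB e1 e2 e3).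
Proof.
move=> codazziB.
have := codazziB e1 e3 e1.
rewrite (bott_codazzi_defect e12 e13 e23 g_lorentzian e_pseudo_orthonormal
           nablaL_levi_civita TG_splitting nablaB_bott) -(Ccst0 G).
move=> /Ccst_inj/eqP; apply/negP.
by rewrite mulf_neq0 ?expf_neq0// oppr_eq0 mulf_neq0 ?invr_eq0 ?pnatr_eq0.
Qed.
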